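(* Let $\mathcal K$ be the class of initially finite trees satisfying VC$^\sharp$. Then each poset $\mathbb X\in\langle\mathcal K\rangle$ satisfies VC$^\sharp$. More precisely, if $\mathbb X=\dot\bigcup_{i<n}\prod_{j<m_i}\mathbb X^i_j$ (a disjoint union of finite direct products with pairwise disjoint domains), where $n\in\mathbb N$, $m_i\in\mathbb N$ for $i<n$, and $\mathbb X^i_j\in\mathcal K$ for all $i<n$, $j<m_i$, then: $I(\mathbb X)\le 1$ if $I(\mathbb X^i_j)\le 1$ for all $i<n$ and $j<m_i$; and $I(\mathbb X)=\mathfrak c$ if $I(\mathbb X^i_j)=\mathfrak c$ for some $i<n$ and $j<m_i$.
   Context: Posets are structures $\langle X,\le\rangle$ in the language with one binary relation symbol, with $\le$ reflexive, antisymmetric and transitive. A tree is a poset in which every set $(-\infty,x]=\{y:y\le x\}$ is linearly ordered. The (connected) components of a poset are the classes of the smallest equivalence relation containing $\le$. A tree is rooted if it has a smallest element $r$ (its root); then $\mathbb X^+:=\mathbb X\setminus\{r\}$ (induced order). A tree is initially finite if it is rooted and $\mathbb X^+$ has finitely many components. $\mathbb N=\{1,2,\dots\}$, $\mathfrak c=2^{\aleph_0}$. For a structure $\mathbb X$, $I(\mathbb X)$ is the number of non-isomorphic countable models of the complete theory $\mathrm{Th}(\mathbb X)$, with the convention that $I(\mathbb X)=0$ iff $\mathbb X$ is finite. $\mathbb X$ satisfies VC$^\sharp$ iff $I(\mathbb X)\in\{0,1,\mathfrak c\}$. Direct products carry the coordinatewise order; in a disjoint union, elements of different summands are incomparable.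 $\langle\mathcal K\rangle$ is the smallest class of structures containing $\mathcal K$ and closed under binary direct products and binary disjoint unions; its members are exactly (up to isomorphism) the finite disjoint unions of finite direct products of structures from $\mathcal K$, one-factor products and one-summand unions being allowed. *)

(* Defs.v *)
From Stdlib Require Relations.
From mathcomp Require Import all_boot.
From mathcomp Require Import boolp classical_sets cardinality.

Set Implicit Arguments.
Unset Strict Implicit.
Unset Printing Implicit Defensive.

Local Open Scope classical_set_scope.
Local Open Scope card_scope.

Record structure := Structure {
  carrier :> Type;
  le : carrier -> carrier -> Prop }.

Arguments le {s} _ _.

Definition isomorphic (X Y : structure) : Prop :=
  exists f : X -> Y, bijective f /\ forall x y, le x y <-> le (f x) (f y).

(* First-order formulas with equality in the language with one binary relation
   symbol, with free variables among 'I_n. The variable bound by [All] is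
   [ord0]; the free variables of the quantified formula are shifted by one. *)
Inductive formula : nat -> Type :=
| Le n : 'I_n -> 'I_n -> formula n
| Eq n : 'I_n -> 'I_n -> formula n
| Bot n : formula n
| Imp n : formula n -> formula n -> formula n
| All n : formula n.+1 -> formula n.

Definition extend (T : Type) n (v : 'I_n -> T) (x : T) (i : 'I_n.+1) : T :=
  if unlift ord0 i is Some j then v j else x.

Fixpoint sat (X : structure) n (phi : formula n) : ('I_n -> X) -> Prop :=
  match phi in formula k return ('I_k -> X) -> Prop with
  | Le _ i j => fun v => le (v i) (v j)
  | Eq _ i j => fun v => v i = v j
  | Bot _ => fun=> False
  | Imp _ phi psi => fun v => sat phi v -> sat psi v
  | All _ phi => fun v => forall x, sat phi (extend v x)
  end.

Definition no_vars (T : Type) (i : 'I_0) : T :=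
  match notF (ltn_ord i) with end.

Definition Th (X : structure) : set (formula 0) :=
  [set phi | sat phi (@no_vars X)].

Definition is_model (T : set (formula 0)) (Y : structure) : Prop :=
  T `<=` Th Y.

(* The isomorphism type of a countably infinite structure, given by its
   isomorphic copies with domain nat. *)
Definition iso_type (Y : structure) : set (nat -> nat -> Prop) :=
  [set R | isomorphic Y (Structure R)].

(* The set of isomorphism types of countable models of Th(X), made empty by
   convention when X is finite; its cardinality is I(X). If X is infinite then
   every model of Th(X) is infinite, so that [iso_type] loses no information on
   countable models. *)
Definition I_types (X : structure) : set (set (nat -> nat -> Prop)) :=
  [set C | infinite_set [set: X] /\
    exists Y : structure,
      [/\ countable [set: Y], is_model (Th X) Y & C = iso_type Y]].

Definition I_eq_continuum (X : structure) : Prop := I_types X #= [set: set nat].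

Definition VCsharp (X : structure) : Prop :=
  [\/ I_types X #= `I_0, I_types X #= `I_1 | I_eq_continuum X].

Definition is_poset (X : structure) : Prop :=
  Relation_Definitions.order X (@le X).

Definition is_tree (X : structure) : Prop :=
  is_poset X /\
  forall x y z : X, le y x -> le z x -> le y z \/ le z y.

Definition components (X : structure) : set (set X) :=
  range (fun x : X =>
    [set y | Relation_Operators.clos_refl_sym_trans X (@le X) x y]).

Arguments components : clear implicits.

Definition is_root (X : structure) (r : X) : Prop := forall x : X, le r x.

Definition remove (X : structure) (r : X) : structure :=
  @Structure {x : X | x <> r} (fun x y => le (sval x) (sval y)).

Definition initially_finite_tree (X : structure) : Prop :=
  is_tree X /\
  exists r : X, is_root r /\ finite_set (components (remove r)).

Definition classK (X : structure) : Prop :=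
  initially_finite_tree X /\ VCsharp X.

Definition product2 (X Y : structure) : structure :=
  @Structure (X * Y) (fun p q => le p.1 q.1 /\ le p.2 q.2).

Definition dunion2 (X Y : structure) : structure :=
  @Structure (X + Y) (fun p q =>
    match p, q with
    | inl x, inl x' => le x x'
    | inr y, inr y' => le y y'
    | _, _ => False
    end).

(* The class generated by K. Closure under isomorphism makes it contain
   every disjoint union of members with disjoint domains, whatever the
   representation of that union. *)
Inductive generated (K : structure -> Prop) : structure -> Prop :=
| gen_base X : K X -> generated K X
| gen_product X Y : generated K X -> generated K Y ->
    generated K (product2 X Y)
| gen_dunion X Y : generated K X -> generated K Y ->
    generated K (dunion2 X Y)
| gen_iso X Y : isomorphic X Y -> generated K X -> generated K Y.

Definition product (J : Type) (S : J -> structure) : structure :=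
  @Structure (forall j, S j) (fun x y => forall j, le (x j) (y j)).

Inductive dunion_le (J : Type) (S : J -> structure) :
    {j : J & S j} -> {j : J & S j} -> Prop :=
| DunionLe j (x y : S j) : le x y ->
    dunion_le (existT (fun j => S j) j x) (existT (fun j => S j) j y).

Definition dunion (J : Type) (S : J -> structure) : structure :=
  @Structure {j : J & S j} (@dunion_le J S).

(* Main.v *)
(* Ehrenfeucht-Fraisse games replace formulas throughout. In a disjoint union of
   products of rooted trees the summands are the up-sets of the minimal elements,
   and inside a summand with minimal element r the elements whose down-set is a
   chain are those with at most one coordinate different from the root. These axes
   minus r split into components, finitely many because the factors are initially
   finite, so each factor is definable as r together with a finite set of named
   components. Hence every Z elementarily equivalent to the sum is again such a sum,
   with factors elementarily equivalent to the original ones (a pigeonhole over the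
   finitely many ways to name components makes the choice independent of the rank),
   and omega-categoricity passes to the sum. Conversely, replacing one factor by a
   countable model W of its theory keeps the theory of the sum, and W is recovered
   from the sum and finitely many elements, so W |-> sum is countable-to-one on
   isomorphism types, and a countable-to-one image of the continuum has size
   continuum. *)
Require Import Defs.
From mathcomp Require Import all_boot.
From mathcomp Require Import boolp classical_sets cardinality.

Set Implicit Arguments.
Unset Strict Implicit.
Unset Printing Implicit Defensive.

Local Open Scope classical_set_scope.
Local Open Scope card_scope.

(** * Ehrenfeucht-Fraisse games *)

Implicit Types X Y Z : structure.

(** Positions are indexed by arbitrary types, a new point going to [None], so that renaming,
    forgetting and repeating variables are all precomposition with a function. *)
Definition ext (T V : Type) (v : V -> T) (x : T) (o : option V) : T :=
  if o is Some u then v u else x.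

Fixpoint eqv (k : nat) (X Y : structure) (V : Type) (v : V -> X) (w : V -> Y) :
    Prop :=
  match k with
  | 0 => forall a b, (le (v a) (v b) <-> le (w a) (w b)) /\
                     (v a = v b <-> w a = w b)
  | k'.+1 => (forall x, exists y, eqv k' (ext v x) (ext w y)) /\
             (forall y, exists x, eqv k' (ext v x) (ext w y))
  end.

Lemma eqv_sym k X Y V (v : V -> X) (w : V -> Y) : eqv k v w -> eqv k w v.
Proof.
elim: k V v w => [|k IH] V v w /=.
  by move=> H a b; have [[? ?] [? ?]] := H a b.
by case=> F B; split=> [y|x]; [have [x] := B y|have [y] := F x];
  move=> /IH; eexists; eauto.
Qed.

Lemma eqv_trans k X Y Z V (v : V -> X) (w : V -> Y) (u : V -> Z) :
  eqv k v w -> eqv k w u -> eqv k v u.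
Proof.
elim: k V v w u => [|k IH] V v w u /=.
  move=> H1 H2 a b; have [h1 h2] := H1 a b; have [h3 h4] := H2 a b.
  by split; [apply: iff_trans h1 h3|apply: iff_trans h2 h4].
case=> F1 B1 [F2 B2]; split=> [x|z].
  have [y /IH h] := F1 x; have [z /h hz] := F2 y; by exists z.
by have [y h] := B2 z; have [x /IH hx] := B1 y; exists x; apply: hx h.
Qed.

(** Since [f] is arbitrary, dropping points and relabelling them are both instances; after a move
    [f] is continued by [omap f]. *)
Lemma eqv_reindex k X Y V W (f : W -> V) (v : V -> X) (w : V -> Y) :
  eqv k v w -> eqv k (v \o f) (w \o f).
Proof.
elim: k V W f v w => [|k IH] V W f v w /=; first by move=> H a b; apply: H.
have E T (v' : V -> T) x : ext (v' \o f) x = ext v' x \o omap f.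
  by apply: funext; case.
case=> F B; split=> [x|y].
  by have [y /(IH _ _ (omap f)) h] := F x; exists y; rewrite !E.
by have [x /(IH _ _ (omap f)) h] := B y; exists x; rewrite !E.
Qed.

Lemma eqv_restrict k X Y V (v : V -> X) (w : V -> Y) x y :
  eqv k (ext v x) (ext w y) -> eqv k v w.
Proof. exact: (@eqv_reindex _ _ _ _ _ Some). Qed.

Lemma eqvW k X Y V (v : V -> X) (w : V -> Y) : eqv k.+1 v w -> eqv k v w.
Proof.
elim: k V v w => [|k IH] V v w [F B].
  (* The extra round is spent on a point already on the board, then forgotten; it exists because a
     variable [a] is at hand. *)
  by move=> a; have [y h] := F (v a); apply: (@eqv_restrict 0 _ _ _ _ _ _ _ h).
split=> [x|y]; first by have [y /IH] := F x; exists y.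
by have [x /IH] := B y; exists x.
Qed.

Lemma eqv_le k l X Y V (v : V -> X) (w : V -> Y) :
  (k <= l)%N -> eqv l v w -> eqv k v w.
Proof.
move=> /subnK <-; elim: (l - k) => // m IH; rewrite addSn => /eqvW; exact: IH.
Qed.

Definition join (T V W : Type) (v : V -> T) (a : W -> T) (u : V + W) : T :=
  match u with inl i => v i | inr j => a j end.

(** A whole finite tuple is played at once, at the price of one round per entry. *)
Lemma eqv_play k X Y V (W : finType) (v : V -> X) (w : V -> Y) :
  eqv (#|W| + k) v w ->
  forall a : W -> X, exists b : W -> Y, eqv k (join v a) (join w b).
Proof.
suff ord m : eqv (m + k) v w ->
  forall a : 'I_m -> X, exists b : 'I_m -> Y, eqv k (join v a) (join w b).
  move=> /ord h a; have [b /(eqv_reindex (fun u => match u with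
    | inl i => inl i | inr j => inr (enum_rank j) end))] := h (a \o enum_val).
  move=> e; exists (b \o enum_rank); congr eqv: e; apply: funext; case=> //= j.
  by rewrite enum_rankK.
elim: m V v w => [|m IH] V v w.
  move=> h a; exists (fun i : 'I_0 => match notF (ltn_ord i) with end).
  apply: (@eqv_le _ k) => //.
  have -> : join v a = v \o (fun u : V + 'I_0 => match u with
    | inl i => i | inr j => match notF (ltn_ord j) with end end).
    by apply: funext; case=> // -[].
  set w' := join _ _.
  have -> : w' = w \o (fun u : V + 'I_0 => match u with
    | inl i => i | inr j => match notF (ltn_ord j) with end end).
    by apply: funext; case=> // -[].
  exact: eqv_reindex.
case=> F _ a; have [y /IH h] := F (a ord0).
have [b hb] := h (a \o lift ord0).
exists (fun i => if unlift ord0 i is Some j then b j else y).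
move: hb => /(eqv_reindex (fun u : V + 'I_m.+1 => match u with
  | inl i => inl (Some i)
  | inr j => if unlift ord0 j is Some j' then inr j' else inl None end)).
congr eqv; apply: funext; case=> //= j; case: unliftP => //= [j' ->|->] //.
Qed.

(** Elementary equivalence in game form; [EF_model] and [sat_EF] identify it with [Y] being a model
    of [Th X]. *)
Definition EFequiv (X Y : structure) := forall k, eqv k (@no_vars X) (@no_vars Y).

Lemma eqv_void k X Y V (v : V -> X) (w : V -> Y) :
  (V -> False) -> eqv k (@no_vars X) (@no_vars Y) -> eqv k v w.
Proof.
move=> V0 /(eqv_reindex (fun u => match V0 u with end)).
by congr eqv; apply: funext => u; case: (V0 u).
Qed.

Lemma EF_sym X Y : EFequiv X Y -> EFequiv Y X.
Proof. by move=> h k; apply: eqv_sym. Qed.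

Lemma EF_trans X Y Z : EFequiv X Y -> EFequiv Y Z -> EFequiv X Z.
Proof. by move=> h1 h2 k; apply: eqv_trans (h1 k) (h2 k). Qed.

Lemma iso_bij (T U : Type) (f : T -> U) :
  injective f -> (forall y, exists x, f x = y) -> bijective f.
Proof.
move=> fI /choice[g fg]; exists g => // x; by apply: fI; rewrite fg.
Qed.

Lemma iso_refl X : isomorphic X X.
Proof. by exists id; split; first by exists id. Qed.

Lemma iso_sym X Y : isomorphic X Y -> isomorphic Y X.
Proof.
case=> f [[g fK gK] h]; exists g; split; first by exists f.
by move=> x y; rewrite -{1}(gK x) -{1}(gK y) -h.
Qed.

Lemma iso_trans X Y Z : isomorphic X Y -> isomorphic Y Z -> isomorphic X Z.
Proof.
case=> f [fb fh] [g [gb gh]]; exists (g \o f); split; first exact: bij_comp.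
by move=> x y; rewrite fh gh.
Qed.

Lemma iso_eqv X Y (f : X -> Y) : bijective f ->
  (forall x y, le x y <-> le (f x) (f y)) ->
  forall k V (v : V -> X), eqv k v (f \o v).
Proof.
move=> fb fh k; have fI := bij_inj fb; case: fb => g fK gK.
elim: k => [|k IH] V v /=.
  by move=> a b; split=> //; split=> [->//|/fI].
have E x : ext (f \o v) (f x) = f \o ext v x by apply: funext; case.
split=> [x|y]; first by exists (f x); have := IH _ (ext v x); rewrite -E.
by exists (g y); have := IH _ (ext v (g y)); rewrite -E gK.
Qed.

Lemma iso_EF X Y : isomorphic X Y -> EFequiv X Y.
Proof.
case=> f [fb fh] k; move: (iso_eqv fb fh k (@no_vars X)).
by congr eqv; apply: funext; case.
Qed.

(* Definability, measured by the length of a game instead of a formula. *)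
Definition fo (V : Type) (P : forall X : structure, (V -> X) -> Prop) : Prop :=
  exists q, forall X Y (v : V -> X) (w : V -> Y), eqv q v w -> P X v -> P Y w.

Lemma fo_le V a b : fo (fun X (v : V -> X) => le (v a) (v b)).
Proof. by exists 0 => X Y v w h; case: (h a b) => -[]. Qed.

Lemma fo_eq V a b : fo (fun X (v : V -> X) => v a = v b).
Proof. by exists 0 => X Y v w h; case: (h a b) => _ []. Qed.

Lemma fo_prop V (A : Prop) : fo (fun X (v : V -> X) => A).
Proof. by exists 0. Qed.

Lemma fo_imp V P Q : fo P -> fo Q -> fo (fun X (v : V -> X) => P X v -> Q X v).
Proof.
move=> [p hp] [q hq]; exists (maxn p q) => X Y v w h H Pw.
apply: hq (eqv_le (leq_maxr _ _) h) (H _).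
exact: hp (eqv_sym (eqv_le (leq_maxl _ _) h)) Pw.
Qed.

Lemma fo_not V P : fo P -> fo (fun X (v : V -> X) => ~ P X v).
Proof. by move=> h; apply: fo_imp h (fo_prop _ _). Qed.

Lemma fo_and V P Q : fo P -> fo Q -> fo (fun X (v : V -> X) => P X v /\ Q X v).
Proof.
move=> [p hp] [q hq]; exists (maxn p q) => X Y v w h [Pv Qv]; split.
  exact: hp (eqv_le (leq_maxl _ _) h) Pv.
exact: hq (eqv_le (leq_maxr _ _) h) Qv.
Qed.

Lemma fo_or V P Q : fo P -> fo Q -> fo (fun X (v : V -> X) => P X v \/ Q X v).
Proof.
move=> [p hp] [q hq]; exists (maxn p q) => X Y v w h [Pv|Qv].
  by left; apply: hp (eqv_le (leq_maxl _ _) h) Pv.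
by right; apply: hq (eqv_le (leq_maxr _ _) h) Qv.
Qed.

(** A quantifier costs one round: the challenge in [Y] is pulled back to [X], where the hypothesis
    applies. *)
Lemma fo_all V (Q : forall X : structure, (V -> X) -> X -> Prop) :
  fo (fun X (v : option V -> X) => Q X (fun u => v (Some u)) (v None)) ->
  fo (fun X v => forall z, Q X v z).
Proof.
case=> q hq; exists q.+1 => X Y v w [_ B] h y; have [x hx] := B y.
exact: hq hx (h x).
Qed.

Lemma fo_ex V (Q : forall X : structure, (V -> X) -> X -> Prop) :
  fo (fun X (v : option V -> X) => Q X (fun u => v (Some u)) (v None)) ->
  fo (fun X v => exists z, Q X v z).
Proof.
case=> q hq; exists q.+1 => X Y v w [F _] [x h]; have [y hy] := F x.
by exists y; apply: hq hy h.
Qed.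

Lemma fo_all_tuple V (W : finType)
    (Q : forall X : structure, (V -> X) -> (W -> X) -> Prop) :
  fo (fun X (v : V + W -> X) => Q X (fun u => v (inl u)) (fun i => v (inr i))) ->
  fo (fun X v => forall a : W -> X, Q X v a).
Proof.
case=> q hq; exists (#|W| + q) => X Y v w /eqv_sym/eqv_play h H b.
have [a /eqv_sym ha] := h b; exact: hq ha (H a).
Qed.

(** The maximum of finitely many ranks serves all indices. *)
Lemma uniform_rank (I : finType) (P : I -> nat -> Prop) :
  (forall i m n, (m <= n)%N -> P i m -> P i n) ->
  (forall i, exists n, P i n) -> exists n, forall i, P i n.
Proof.
move=> mono /choice[f hf]; exists (\max_i f i) => i.
exact: mono (leq_bigmax i) (hf i).
Qed.

Lemma fo_forall V (I : finType) (P : I -> forall X : structure, (V -> X) -> Prop) :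
  (forall i, fo (P i)) -> fo (fun X v => forall i, P i X v).
Proof.
move=> h; have [||q hq] := @uniform_rank I (fun i q => forall X Y (v : V -> X) (w : V -> Y),
  eqv q v w -> P i X v -> P i Y w) => //.
  by move=> i m n mn H X Y v w /(eqv_le mn); apply: H.
by exists q => X Y v w e H i; apply: hq e (H i).
Qed.

Lemma fo_exists V (I : finType) (P : I -> forall X : structure, (V -> X) -> Prop) :
  (forall i, fo (P i)) -> fo (fun X v => exists i, P i X v).
Proof.
move=> h; have [||q hq] := @uniform_rank I (fun i q => forall X Y (v : V -> X) (w : V -> Y),
  eqv q v w -> P i X v -> P i Y w) => //.
  by move=> i m n mn H X Y v w /(eqv_le mn); apply: H.
by exists q => X Y v w e [i H]; exists i; apply: hq e H.
Qed.

Lemma fo_reindex V W (f : W -> V) (P : forall X : structure, (W -> X) -> Prop) :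
  fo P -> fo (fun X v => P X (fun u => v (f u))).
Proof. by case=> q hq; exists q => X Y v w /(eqv_reindex (f)); apply: hq. Qed.

(** * Formulas and games *)

Lemma eqv_extend k X Y n (v : 'I_n -> X) (w : 'I_n -> Y) x y :
  eqv k (extend v x) (extend w y) <-> eqv k (ext v x) (ext w y).
Proof.
split=> [|/(eqv_reindex (unlift ord0)) //].
move=> /(eqv_reindex (fun o => oapp (lift ord0) ord0 o)).
by congr eqv; apply: funext; case=> [i|] /=; rewrite /extend ?liftK ?unlift_none.
Qed.

Lemma fo_sat n (phi : formula n) : fo (fun X v => sat (X := X) phi v).
Proof.
elim: n / phi => [n i j|n i j|n|n phi IH1 psi IH2|n phi IH] /=.
- exact: fo_le.
- exact: fo_eq.
- exact: fo_prop.
- exact: fo_imp.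
apply: fo_all; move: IH => /(fo_reindex (unlift ord0)) [q hq].
exists q => X Y v w /hq; congr (_ -> _); congr (sat phi _);
  by apply: funext => i /=; rewrite /extend; case: unlift.
Qed.

Lemma EF_model X Y : EFequiv X Y -> is_model (Th X) Y.
Proof. by move=> h phi; have [q hq] := fo_sat phi; apply: hq. Qed.

Definition And n (p q : formula n) := Imp (Imp p (Imp q (Bot n))) (Bot n).
Definition Neg n (p : formula n) := Imp p (Bot n).

Lemma sat_And X n (p q : formula n) (v : 'I_n -> X) :
  sat (And p q) v <-> sat p v /\ sat q v.
Proof.
split=> /= [h|[hp hq] /(_ hp)]; last exact.
by split; apply: contrapT => h'; apply: h => // ? ?.
Qed.

(* Fraisse's theorem: the formulas of level k+1 say which types of level k are
   realized by one more point. *)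
Lemma eqv_formulas k n : exists (T : finType) (L : T -> formula n),
  forall X Y (v : 'I_n -> X) (w : 'I_n -> Y),
  (forall t, sat (L t) v <-> sat (L t) w) -> eqv k v w.
Proof.
elim: k n => [|k IH] n.
  exists ('I_n * 'I_n * bool)%type.
  exists (fun t => if t.2 then Le t.1.1 t.1.2 else Eq t.1.1 t.1.2) => X Y v w h a b.
  by split; [apply: (h (a, b, true))|apply: (h (a, b, false))].
have [T [L hL]] := IH n.+1.
(* [C f] is the complete description that makes [L t] true exactly when [f t] holds. *)
pose C (f : {ffun T -> bool}) : formula n.+1 :=
  foldr (fun t p => And (if f t then L t else Neg (L t)) p) (Neg (Bot _)) (enum T).
have satC X (v : 'I_n.+1 -> X) f :
    sat (C f) v <-> forall t, (sat (L t) v <-> f t).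
  have -> : (forall t, (sat (L t) v <-> f t)) <->
            (forall t, t \in enum T -> (sat (L t) v <-> f t)).
    by split=> [h t _|h t]; [apply h|apply: h; rewrite mem_enum].
  rewrite /C; elim: (enum T) => [|t s IHs].
    by split=> [_ t|_ []]; rewrite ?in_nil.
  rewrite [foldr _ _ _]/= sat_And IHs; split=> [[h1 h2] u|h].
    rewrite inE => /orP[/eqP ->|]; last exact: h2.
    by case: (f t) h1 => /= h1; split.
  split; last by move=> u us; apply: h; rewrite inE us orbT.
  have := h t; rewrite inE eqxx => /(_ isT); case: (f t) => /= -[h1 h2]; first exact: h2.
  by move=> /h1.
exists {ffun T -> bool}, (fun f => Neg (All (Neg (C f)))) => X Y v w h.
suff key X' Y' (v' : 'I_n -> X') (w' : 'I_n -> Y') :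
    (forall f, sat (Neg (All (Neg (C f)))) v' -> sat (Neg (All (Neg (C f)))) w') ->
    forall x, exists y, eqv k (ext v' x) (ext w' y).
  split=> [|y]; first by apply: key => f; apply h.
  by have [|x /eqv_sym] := @key _ _ w v _ y; [move=> f; apply h|exists x].
move=> {X Y v w}h x.
(* The description used is that of [x] itself; it is realized over [v'], hence over [w']. *)
have [y hy] : exists y, sat (C [ffun t => `[<sat (L t) (extend v' x)>]]) (extend w' y).
  apply: contrapT => /= ny; apply: (h [ffun t => `[<sat (L t) (extend v' x)>]]); last first.
    by move=> y hy; apply: ny; exists y.
  move=> /= /(_ x); apply; apply/satC => t; rewrite ffunE.
  by split=> [/asboolT|/asboolW].
exists y.
have /hL : forall t, sat (L t) (extend v' x) <-> sat (L t) (extend w' y).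
  move=> t; move/satC: hy => /(_ t) hy; rewrite hy ffunE.
  by split=> [/asboolT|/asboolW].
by rewrite eqv_extend.
Qed.

(** Since [Th X] is complete, applying the hypothesis to [Neg (L t)] gives the converse
    implication. *)
Lemma sat_EF X Y : is_model (Th X) Y -> EFequiv X Y.
Proof.
move=> h k; have [T [L hL]] := eqv_formulas k 0; apply: hL => t; split; first exact: h.
by move=> sY; apply: contrapT => /(h (Neg (L t))); apply.
Qed.

(** * Games on products, disjoint unions and definable subsets *)

(** The game is played separately in every coordinate, and choice collects the answers. *)
Lemma eqv_product (J : Type) (S S' : J -> structure) k V
    (v : V -> product S) (w : V -> product S') :
  (forall j, eqv k (fun u => v u j) (fun u => w u j)) -> eqv k v w.
Proof.
elim: k V v w => [|k IH] V v w h.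
  move=> a b; split; split=> H.
  - by move=> j; apply/(h j a b).1.
  - by move=> j; apply/(h j a b).1.
  - by apply: functional_extensionality_dep => j; apply/(h j a b).2; rewrite H.
  - by apply: functional_extensionality_dep => j; apply/(h j a b).2; rewrite H.
have E (S0 : J -> structure) (v0 : V -> product S0) (x : product S0) j :
    (fun u => ext v0 x u j) = ext (fun u => v0 u j) (x j).
  by apply: funext; case.
split=> [x|y].
  pose g j := cid ((h j).1 (x j)); exists (fun j => sval (g j)).
  by apply: IH => j; rewrite !E; exact: svalP (g j).
pose g j := cid ((h j).2 (y j)); exists (fun j => sval (g j)).
by apply: IH => j; rewrite !E; exact: svalP (g j).
Qed.

Lemma EF_product (J : Type) (S S' : J -> structure) :
  (forall j, EFequiv (S j) (S' j)) -> EFequiv (product S) (product S').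
Proof. by move=> h k; apply: eqv_product => j; apply: eqv_void (h j k) => -[]. Qed.

Lemma dunion_leE (J : eqType) (S : J -> structure) j (x y : S j) :
  le (existT (fun j => S j) j x : dunion S) (existT (fun j => S j) j y) <-> le x y.
Proof.
split=> [h|]; last exact: DunionLe.
have [e] : exists e : j = j, le (ecast j (S j) e x) y.
  change (exists e : projT1 (existT (fun j => S j) j x) = projT1 (existT (fun j => S j) j y),
    le (ecast j (S j) e (projT2 (existT (fun j => S j) j x)))
       (projT2 (existT (fun j => S j) j y))).
  by case: h => j' x' y' l; exists erefl.
by rewrite eq_axiomK.
Qed.

Lemma dunion_le_tag (J : Type) (S : J -> structure) (p q : dunion S) :
  le p q -> projT1 p = projT1 q.
Proof. by case. Qed.

(* The total valuations [v j] are only read where [s] takes the value [j]; after a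
   move into one summand they are extended by [d] in the others. *)
Lemma eqv_dunion (J : eqType) (S S' : J -> structure) (d : forall j, S j)
    (d' : forall j, S' j) k V (s : V -> J)
    (v : forall j, V -> S j) (w : forall j, V -> S' j) :
  (forall j, eqv k (v j) (w j)) ->
  eqv k (fun u => existT (fun j => S j) (s u) (v (s u) u) : dunion S)
        (fun u => existT (fun j => S' j) (s u) (w (s u) u) : dunion S').
Proof.
elim: k V s v w => [|k IH] V s v w h.
  move=> a b; split; split=> H.
  - have /= e := dunion_le_tag H; move: H => /=; rewrite -e => /dunion_leE H.
    exact/dunion_leE/(h _ a b).1.
  - have /= e := dunion_le_tag H; move: H => /=; rewrite -e => /dunion_leE H.
    exact/dunion_leE/(h _ a b).1.
  - have /= e := congr1 (@projT1 _ _) H; move: H => /=; rewrite -e => /(@existT_inj2 _ S) H.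
    by congr existT; apply/(h _ a b).2.
  - have /= e := congr1 (@projT1 _ _) H; move: H => /=; rewrite -e => /(@existT_inj2 _ S') H.
    by congr existT; apply/(h _ a b).2.
have E (S0 : J -> structure) (v0 : forall j, V -> S0 j) j0 (x : forall j, S0 j) :
    ext (fun u => existT (fun j => S0 j) (s u) (v0 (s u) u) : dunion S0)
        (existT (fun j => S0 j) j0 (x j0)) =
    fun o => existT (fun j => S0 j) (ext s j0 o) (ext (v0 (ext s j0 o)) (x (ext s j0 o)) o).
  by apply: funext; case.
split=> [[j0 x0]|[j0 x0]].
  pose x := dfwith d x0; pose g j := cid ((h j).1 (x j)).
  exists (existT (fun j => S' j) j0 (sval (g j0))).
  have <- : x j0 = x0 by exact: dfwith_in.
  rewrite (E S v j0 x) (E S' w j0 (fun j => sval (g j))).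
  apply: (IH _ _ (fun j => ext (v j) (x j)) (fun j => ext (w j) (sval (g j)))) => j.
  exact: svalP (g j).
pose x := dfwith d' x0; pose g j := cid ((h j).2 (x j)).
exists (existT (fun j => S j) j0 (sval (g j0))).
have <- : x j0 = x0 by exact: dfwith_in.
rewrite (E S' w j0 x) (E S v j0 (fun j => sval (g j))).
apply: (IH _ _ (fun j => ext (v j) (sval (g j))) (fun j => ext (w j) (x j))) => j.
exact: svalP (g j).
Qed.

Lemma EF_dunion (J : eqType) (S S' : J -> structure) (d : forall j, S j)
    (d' : forall j, S' j) :
  (forall j, EFequiv (S j) (S' j)) -> EFequiv (dunion S) (dunion S').
Proof.
move=> h k.
have := @eqv_dunion J S S' d d' k 'I_0 (@no_vars J) (fun j => @no_vars (S j))
  (fun j => @no_vars (S' j)) (fun j => h j k).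
by congr eqv; apply: funext; case.
Qed.

Definition sub X (D : X -> Prop) : structure :=
  @Structure {x : X | D x} (fun x y => le (sval x) (sval y)).

Lemma sval_inj (T : Type) (D : T -> Prop) : injective (@sval T D).
Proof. by move=> [x hx] [y hy] /= e; apply: eq_exist. Qed.

(** Keeping [q] rounds in reserve forces every answer to a move inside [D] to lie in [D] as well. *)
Lemma eqv_sub V (D : forall X, (V -> X) -> X -> Prop) :
  fo (fun X (v : option V -> X) => D X (fun u => v (Some u)) (v None)) ->
  exists q, forall k X Y (v : V -> X) (w : V -> Y), eqv (k + q) v w ->
    eqv k (@no_vars (sub (D X v))) (@no_vars (sub (D Y w))).
Proof.
case=> q hq; exists q => k X Y v w.
(* The parameters stay on the board in the large structures, since [D] depends on them. *)
suff key W (a : W -> sub (D X v)) (b : W -> sub (D Y w)) :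
    eqv (k + q) (join v (fun i => sval (a i))) (join w (fun i => sval (b i))) ->
    eqv k a b.
  move=> /(eqv_reindex (fun u : V + 'I_0 => match u with
    | inl i => i | inr j => match notF (ltn_ord j) with end end)) h; apply: key.
  by move: h; congr eqv; apply: funext; case=> // -[].
elim: k W a b => [|k IH] W a b h.
  move=> i j; have h' := @eqv_le 0 _ _ _ _ _ _ (leq0n _) h.
  have [h1 h2] := h' (inr i) (inr j); split; first exact: h1.
  by split=> [/(congr1 sval)|/(congr1 sval)] /h2 /sval_inj.
have aux X' Y' (v' : V -> X') (w' : V -> Y') (a' : W -> sub (D X' v'))
   (b' : W -> sub (D Y' w')) :
   eqv (k.+1 + q) (join v' (fun i => sval (a' i))) (join w' (fun i => sval (b' i))) ->
   forall x : sub (D X' v'), exists y : sub (D Y' w'),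
     eqv (k + q) (join v' (fun i => sval (ext a' x i)))
                 (join w' (fun i => sval (ext b' y i))).
  rewrite addSn => -[F _] x; have [y hy] := F (sval x).
  have Dy : D Y' w' y.
    have := @eqv_le q _ _ _ _ _ _ (leq_addl k q) hy.
    move=> /(eqv_reindex (omap inl)) /hq; apply; exact: svalP x.
  exists (exist _ y Dy).
  move: hy => /(eqv_reindex (fun u : V + option W => match u with
    | inl i => Some (inl i) | inr (Some j) => Some (inr j) | inr None => None end)).
  by congr eqv; apply: funext; case=> // -[].
split=> [x|y]; first by have [y /IH] := aux _ _ _ _ _ _ h x; exists y.
by have [x /eqv_sym/IH] := aux _ _ _ _ _ _ (eqv_sym h) y; exists x.
Qed.

(** * The downward Löwenheim-Skolem theorem *)

Section Skolem.
Variables (X : structure) (x0 : X).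

(** Finitely many formulas decide the type of level [k], so it is coded by a natural number; this
    leaves only countably many Skolem functions. *)
Lemma eqv_code k n : exists c : ('I_n -> X) -> nat,
  forall v w, c v = c w -> eqv k v w.
Proof.
have [T [L hL]] := eqv_formulas k n.
exists (fun v => pickle [ffun t => `[<sat (L t) v>]]) => v w /(pcan_inj pickleK).
move=> /ffunP e; apply: hL => t; have := e t; rewrite !ffunE; apply: asbool_eq_equiv.
Qed.

Definition code k n : ('I_n -> X) -> nat := sval (cid (eqv_code k n)).

(** A Skolem function: one for each level [k], arity [n] and code [m] of a type, with default [x0]
    when the type is not realized. *)
Definition witness k n m (v : 'I_n -> X) : X :=
  if pselect (exists x, code k (extend v x) = m) is left h then sval (cid h) else x0.

(** Finite trees labelled by numbers are the Skolem terms: a label codes the Skolem function and the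
    children are its arguments. They form a countable type; leaves and missing arguments evaluate to
    [x0]. *)
Fixpoint hull_term (t : GenTree.tree nat) : X :=
  if t is GenTree.Node a ts then
    let: (k, n, m) := odflt (0, 0, 0)%N (unpickle a) in
    witness k m (fun i : 'I_n => nth x0 (map hull_term ts) i)
  else x0.

Lemma witness_hull k n m (v : 'I_n -> X) :
  (forall i, exists t, hull_term t = v i) -> exists t, hull_term t = witness k m v.
Proof.
move=> /choice[t ht].
exists (GenTree.Node (pickle (k, n, m)) (map t (enum 'I_n))).
rewrite /= pickleK /=; congr witness; apply: funext => i.
by rewrite -map_comp (nth_map i) ?size_enum_ord //= nth_ord_enum ht.
Qed.

Lemma witnessP k n (v : 'I_n -> X) x :
  eqv k (extend v (witness k (code k (extend v x)) v)) (extend v x).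
Proof.
rewrite /witness; case: pselect => [h|[]]; last by exists x.
by case: cid => /= y; apply: (svalP (cid (eqv_code k n.+1))).
Qed.

Lemma countable_EF : exists Y, countable [set: Y] /\ EFequiv X Y.
Proof.
exists (sub (fun x => exists t, hull_term t = x)); split.
  apply/countable_injP; set D := sub _.
  exists (fun d : D => pickle (sval (cid (svalP d)))) => d e _ _ /(pcan_inj pickleK) E.
  apply: sval_inj; rewrite -(svalP (cid (svalP d))) -(svalP (cid (svalP e))).
  by rewrite E.
set D := sub _.
(* The game between the hull and [X] is reduced to a game between two tuples of [X]. *)
suff key k n (d : 'I_n -> D) (x : 'I_n -> X) :
    eqv k (fun i => sval (d i)) x -> eqv k d x.
  move=> k; apply/eqv_sym/key.
  have -> : (fun i => sval (@no_vars D i)) = @no_vars X by apply: funext; case.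
  exact: iso_EF (iso_refl X) k.
elim: k n d x => [|k IH] n d x h.
  move=> i j; have [h1 h2] := h i j; split; first exact: h1.
  by rewrite -h2; split=> [->//|/sval_inj].
have E (y : D) : (fun i => sval (extend d y i)) = extend (fun i => sval (d i)) (sval y).
  by apply: funext => i; rewrite /extend; case: unlift.
case: h => F B; split=> [y|y].
  have [z hz] := F (sval y); exists z; apply/eqv_extend/IH; rewrite E.
  exact/eqv_extend.
have [z hz] := B y.
(* The answer [z] may lie outside the hull; it is replaced by a hull point with the same type of
   level [k] over [d]. *)
have [|t ht] := @witness_hull k n (code k (extend (fun i => sval (d i)) z))
  (fun i => sval (d i)); first by move=> i; apply: svalP (d i).
pose y' : D := exist _ (hull_term t) (ex_intro _ t erefl).
exists y'; apply/eqv_extend/IH; rewrite E /= ht.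
apply: eqv_trans (witnessP _ _ _) _; exact/eqv_extend.
Qed.

End Skolem.

(** * Decomposition of models *)

Definition poset X := (forall x : X, le x x) /\
  (forall x y z : X, le x y -> le y z -> le x z) /\
  (forall x y : X, le x y -> le y x -> x = y).

(** In a tree with root [r] this says that [z] and [c] lie in one component of the complement of
    [r]: there, being connected amounts to having a common lower bound, which makes components
    first-order. *)
Definition near X (r z c : X) := exists y, y <> r /\ le y z /\ le y c.

Definition chain X (z : X) := forall a b, le a z -> le b z -> le a b \/ le b a.

(* The generators [c] meet every component of X minus the root [r]. *)
Definition finite_tree X n (r : X) (c : 'I_n -> X) :=
  poset X /\ (forall z : X, chain z) /\ (forall z, le r z) /\
  (forall z, z = r \/ exists t, near r z (c t)).

(** In a product of rooted trees the chain condition leaves at most one coordinate different from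
    the root, and nearness to a generator tells which one. The bottom [r] itself has to be added by
    hand. *)
Definition axis X n (r : X) (c : 'I_n -> X) (z : X) :=
  le r z /\ chain z /\ (z = r \/ exists t, near r z (c t)).

Ltac fo_auto := repeat first
  [ apply: fo_le | apply: fo_eq | apply: fo_and | apply: fo_or | apply: fo_not
  | apply: fo_imp | apply: fo_all | apply: fo_ex | apply: fo_all_tuple
  | apply: fo_forall => ? | apply: fo_exists => ? ].

Lemma fo_finite_tree n :
  fo (fun X (v : option 'I_n -> X) => finite_tree (v None) (fun t => v (Some t))).
Proof. rewrite /finite_tree /poset /chain /near; fo_auto. Qed.

(* [frame tau] states that a structure is the disjoint union over [i] of the
   up-sets of [bottom i], each being the product of its axes [coord j]; the axis
   [coord j] is cut out by representatives [gen t] of its components. *)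
Section Frame.
Variables (I : finType) (J : I -> finType) (n : forall i, J i -> nat).

Definition label : finType := (I + {i : I & {j : J i & 'I_(n j)}})%type.

Section Coordinates.
Variables (X : structure) (tau : label -> X).

Definition bottom i : X := tau (inl i).
Definition gen i (j : J i) (t : 'I_(n j)) : X :=
  tau (inr (existT _ i (existT _ j t))).
Definition coord i (j : J i) : X -> Prop := axis (bottom i) (gen (j := j)).

Definition frame :=
  poset X /\
  (forall z, exists i, le (bottom i) z) /\
  (forall i i' z, le (bottom i) z -> le (bottom i') z -> i = i') /\
  (forall i (j : J i) z, le (bottom i) z -> exists a,
     coord j a /\ le a z /\ forall b, coord j b -> le b z -> le b a) /\
  (forall i z w, le (bottom i) z -> le (bottom i) w ->
     (forall (j : J i) a, coord j a -> le a z -> le a w) -> le z w) /\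
  (forall i (a : J i -> X), (forall j, coord j (a j)) -> exists z,
     le (bottom i) z /\
     forall j, le (a j) z /\ forall b, coord j b -> le b z -> le b (a j)) /\
  (forall i z, le (bottom i) z -> chain z -> z = bottom i \/ exists j : J i, coord j z) /\
  (forall i (j : J i) t, coord j (gen (j := j) t)).

End Coordinates.

Lemma fo_frame : fo frame.
Proof.
rewrite /frame /coord /axis /chain /near /poset /bottom /gen; fo_auto.
exact: fo_prop.
Qed.

Lemma fo_coord i (j : J i) :
  fo (fun X (v : option label -> X) => coord (fun u => v (Some u)) j (v None)).
Proof. rewrite /coord /axis /chain /near /bottom /gen; fo_auto. Qed.

(** A point corresponds to its projections, the greatest points of the axes below it. The clauses of
    [frame] say that projections exist, determine the order and can be prescribed at will; [g]
    builds the point from its projections. *)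
Lemma frame_iso Z (tau : label -> Z) : frame tau ->
  isomorphic Z (dunion (fun i => product (fun j : J i => sub (coord tau j)))).
Proof.
case=> -[refl [trans anti]] [G1 [G2 [G4 [G5 [G6 _]]]]]; apply: iso_sym.
have h i (a : forall j : J i, sub (coord tau j)) := G6 i (fun j => sval (a j)) (fun j => svalP (a j)).
pose g i a := sval (cid (h i a)).
have g1 i a : le (bottom tau i) (g i a) by case: (svalP (cid (h i a))).
have g2 i a j : le (sval (a j)) (g i a).
  by case: (svalP (cid (h i a))) => _ /(_ j) [].
have g3 i a j b : coord tau j b -> le b (g i a) -> le b (sval (a j)).
  by case: (svalP (cid (h i a))) => _ /(_ j) [_]; apply.
have gle i a a' : le (g i a) (g i a') <-> forall j, le (sval (a j)) (sval (a' j)).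
  split=> [l j|l].
    apply: g3; [exact: svalP (a j)|exact: trans (g2 _ _ _) l].
  apply: (G5 i) => // j b Ab bl.
  exact: trans (trans _ _ _ (g3 _ _ _ _ Ab bl) (l j)) (g2 _ _ _).
pose F (p : dunion (fun i => product (fun j : J i => sub (coord tau j)))) : Z :=
  let: existT i a := p in g i a.
exists F; split; last first.
  move=> [i a] [i' a'] /=; split=> [l|l].
    have /= e := dunion_le_tag l; case: i' / e a' l => a' /(dunion_leE (S := fun i => product _)) l.
    exact/gle.
  have e : i = i' by apply: G2 (g1 i' a'); apply: trans l.
  by case: i' / e a' l => a' /gle l; apply/(dunion_leE (S := fun i => product _)).
apply: iso_bij => [[i a] [i' a'] /= E|z].
  have e : i = i' by apply: (G2 _ _ (g i a)) => //; rewrite E.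
  case: i' / e a' E => a' E; congr existT.
  have l1 : le (g i a) (g i a') by rewrite E.
  have l2 : le (g i a') (g i a) by rewrite E.
  apply: functional_extensionality_dep => j; apply: sval_inj.
  by apply: anti; [move/gle: l1|move/gle: l2].
have [i iz] := G1 z; pose a j := cid (G4 i j z iz).
exists (existT _ i (fun j => exist _ (sval (a j)) (svalP (a j)).1)) => /=.
apply: anti; apply: (G5 i) => // j b Ab bz.
  by apply: trans (g3 _ _ j _ Ab bz) _; apply: (svalP (a j)).2.1.
by apply: trans (g2 _ _ j) => /=; apply: (svalP (a j)).2.2.
Qed.

(* Two frames of the same structure differ by a permutation of the bottoms and a
   change of generators inside components, so one tuple names them all. *)
Lemma frame_align Z (t0 t : label -> Z) : frame t0 -> frame t ->
  exists f : {ffun label -> label}, forall i (j : J i),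
    coord (t0 \o f) j = coord t j.
Proof.
case=> -[refl [trans anti]] [A1 [A2 [_ [_ [_ [A7 A8]]]]]].
case=> _ [B1 [B2 [_ [_ [_ [_ B8]]]]]].
(* The bottoms are the minimal elements, so both frames have the same ones. *)
have /choice[p hp] : forall i, exists i', bottom t0 i' = bottom t i.
  move=> i; have [i' h] := A1 (bottom t i); exists i'.
  have [i'' h'] := B1 (bottom t0 i').
  have e := B2 _ _ _ (trans _ _ _ h' h) (refl (bottom t i)).
  by apply: anti => //; rewrite -e.
(* A generator is either a bottom, which names itself, or lies in the component of some generator of
   [t0]. *)
have /choice[q hq] : forall s : {i : I & {j : J i & 'I_(n j)}}, exists u,
    let c := gen t (tagged (tagged s)) in
    c = t0 u \/ near (bottom t (tag s)) c (t0 u) /\ chain (t0 u).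
  move=> [i [j s]] /=; have [l [ch _]] := B8 i j s; rewrite -hp in l.
  have [->|[j' [_ [_ [->|[u h]]]]]] := A7 _ _ l ch.
  - by exists (inl (p i)); left.
  - by exists (inl (p i)); left.
  - exists (inr (existT _ (p i) (existT _ j' u))); right.
    by rewrite -hp; split=> //; case: (A8 (p i) j' u) => _ [].
exists [ffun u => match u with inl i => inl (p i) | inr s => q s end] => i j.
(* The two lower bounds are both below [y], hence comparable, and the smaller one is below [x] and
   [z]. *)
have near_trans r x y z : chain y -> near r x y -> near (X := Z) r y z -> near r x z.
  move=> ch [u [ur [ux uy]]] [w [wr [wy wz]]].
  by have [l|l] := ch u w uy wy; [exists u|exists w]; split=> //; split=> //; apply: trans l _.
have near_sym r x y : near r x y -> near (X := Z) r y x.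
  by move=> [u [ur [ux uy]]]; exists u.
have Eb : bottom (t0 \o [ffun u => match u with inl i => inl (p i) | inr s => q s end]) i
  = bottom t i by rewrite -hp /bottom /= ffunE.
apply: funext => z; rewrite /coord /axis Eb; apply: propext.
suff E s : near (bottom t i) z (gen (t0 \o
    [ffun u => match u with inl i => inl (p i) | inr s => q s end]) s) <->
    near (bottom t i) z (gen t (j := j) s).
  by split=> -[h1 [h2 [h3|[s /E h3]]]]; do 2!split=> //; by [left|right; exists s].
rewrite {1}/gen /= ffunE.
have /= [->//|[h ch]] := hq (existT _ i (existT _ j s)).
have [_ [ch' _]] := B8 i j s.
split=> h'; last exact: near_trans h' h.
by apply: near_trans h' _ => //; apply: near_sym.
Qed.

End Frame.

(** * The frame of a disjoint union of products of trees *)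

Section Standard.
Variables (I : finType) (J : I -> finType) (n : forall i, J i -> nat).
Variables (S : forall i, J i -> structure).
Variables (r : forall i (j : J i), S j) (c : forall i (j : J i), 'I_(n j) -> S j).
Hypothesis ST : forall i (j : J i), finite_tree (r j) (c (j := j)).

Local Notation XX := (dunion (fun i => product (@S i))).

Definition emb i (j : J i) (a : S j) : XX :=
  existT (fun i => product (@S i)) i (dfwith (@r i) a).

Definition standard (u : label n) : XX :=
  match u with
  | inl i => existT (fun i => product (@S i)) i (@r i)
  | inr (existT i (existT j t)) => emb (c t)
  end.

Let refl i (j : J i) (x : S j) : le x x. Proof. by case: (ST j) => -[]. Qed.
Let trans i (j : J i) (x y z : S j) : le x y -> le y z -> le x z.
Proof. by case: (ST j) => -[_ [h _]] _; apply: h. Qed.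
Let anti i (j : J i) (x y : S j) : le x y -> le y x -> x = y.
Proof. by case: (ST j) => -[_ [_ h]] _; apply: h. Qed.
Let root i (j : J i) (x : S j) : le (r j) x.
Proof. by case: (ST j) => _ [_ []]. Qed.
Let leE i (f g : product (@S i)) :
  le (existT (fun i => product (@S i)) i f : XX) (existT (fun i => product (@S i)) i g) <->
  forall j, le (f j) (g j).
Proof. exact: (dunion_leE (S := fun i => product (@S i))). Qed.

Let inj i (f g : product (@S i)) :
  existT (fun i => product (@S i)) i f = existT (fun i => product (@S i)) i g ->
  forall j, f j = g j.
Proof. by move/(@existT_inj2 _ (fun i => product (@S i))) ->. Qed.

Lemma emb_le i (j : J i) (a : S j) (f : product (@S i)) :
  le (emb a) (existT (fun i => product (@S i)) i f : XX) <-> le a (f j).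
Proof.
rewrite leE; split=> [/(_ j)|l j']; first by rewrite dfwith_in.
by case: dfwithP => [//|j'' _]; apply: root.
Qed.

Lemma emb_root i (j : J i) :
  emb (r j) = existT (fun i => product (@S i)) i (@r i) :> XX.
Proof.
congr existT; apply: functional_extensionality_dep => j'; by case: dfwithP.
Qed.

Lemma emb_inj i (j : J i) : injective (@emb i j).
Proof. by move=> a b /inj /(_ j); rewrite !dfwith_in. Qed.

(** Below an axis point the remaining coordinates are still at most, hence equal to, their roots. *)
Lemma le_emb i (j : J i) (a : S j) (p : XX) :
  le p (emb a) -> exists2 b, p = emb b & le b a.
Proof.
case: p => i' f l; have /= e := dunion_le_tag l.
case: i / e j a l => j a /leE l; exists (f j); last first.
  by have := l j; rewrite dfwith_in.
congr existT; apply: functional_extensionality_dep => j'; have := l j'.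
case: dfwithP => [_|j'' ne l']; first by rewrite dfwith_in.
by rewrite dfwith_out //; apply: anti.
Qed.

(** If two coordinates differed from their roots, their embeddings would be incomparable points
    below [f]. *)
Lemma chain_emb i (f : product (@S i)) (j : J i) :
  chain (existT (fun i => product (@S i)) i f : XX) -> f j <> r j ->
  existT (fun i => product (@S i)) i f = emb (f j) :> XX.
Proof.
move=> ch fj; congr existT; apply: functional_extensionality_dep => j'.
case: (eqVneq j j') => [<-|ne]; first by rewrite dfwith_in.
rewrite dfwith_out //; apply: contrapT => fj'.
have [l|l] := ch (emb (f j)) (emb (f j')) ((emb_le _ _).2 (refl _)) ((emb_le _ _).2 (refl _)).
  by move/emb_le: l; rewrite dfwith_out 1?eq_sym // => l; apply: fj; apply: anti.
by move/emb_le: l; rewrite dfwith_out // => l; apply: fj'; apply: anti.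
Qed.

Lemma chain_embP i (j : J i) (a : S j) : chain (emb a : XX).
Proof.
move=> x y /le_emb[b -> lb] /le_emb[d -> ld].
have [_ [ch _]] := ST j.
by have [l|l] := ch a b d lb ld; [left|right]; apply/emb_le; rewrite dfwith_in.
Qed.

(** A point other than the bottom that is below a generator of axis [j] is some [emb b] with [b] not
    the root. Any [z] above it thus has a nontrivial coordinate [j], and [chain_emb] applies. *)
Lemma coord_standard i (j : J i) (z : XX) :
  coord standard j z <-> exists a : S j, z = emb a.
Proof.
split=> [[l [ch h]]|[a ->]]; last first.
  split; first by apply/leE => j'; apply: root.
  split; first exact: chain_embP.
  have [_ [_ [_ /(_ a) [->|[t [y [yr [ya yc]]]]]]]] := ST j.
    by left; rewrite emb_root.
  right; exists t; exists (emb y); split.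
    by move=> e; apply: yr; apply: emb_inj; rewrite e emb_root.
  by split; apply/emb_le; rewrite dfwith_in.
case: z l ch h => i' f l; have /= e := dunion_le_tag l.
case: i' / e f l => f l ch [E|[t [y [yr [yz /le_emb[b E lb]]]]]].
  by exists (r j); rewrite emb_root E.
exists (f j); apply: chain_emb => // fj; apply: yr.
move: yz; rewrite E => /emb_le; rewrite fj => bl.
by rewrite (anti bl (root b)) emb_root.
Qed.

Lemma coord_iso i (j : J i) : isomorphic (S j) (sub (coord standard j)).
Proof.
exists (fun a => exist _ (emb a) ((coord_standard j (emb a)).2 (ex_intro _ a erefl))).
split.
  apply: iso_bij => [a b /(congr1 sval) /emb_inj //|[z /[dup] /coord_standard[a E] h]].
  by exists a; apply: sval_inj; exact: esym E.
by move=> a b; split=> [l|/emb_le]; [apply/emb_le|]; rewrite dfwith_in.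
Qed.

(** The projection of [f] to axis [j] is [emb (f j)], by [great] and [emb_le]; each clause then
    becomes a coordinatewise statement. *)
Lemma standard_frame : frame standard.
Proof.
have splitZ i (z : XX) : le (bottom standard i) z ->
    exists f, z = existT (fun i => product (@S i)) i f.
  by case: z => i' f l; have /= e := dunion_le_tag l; case: i' / e f l => f _; exists f.
have great i (j : J i) (f : product (@S i)) b : coord standard j b ->
    le b (existT (fun i => product (@S i)) i f : XX) -> le b (emb (f j)).
  by move=> /coord_standard[a ->] /emb_le l; apply/emb_le; rewrite dfwith_in.
have embC i (j : J i) (a : S j) : coord standard j (emb a) by apply/coord_standard; exists a.
split; [|split; [|split; [|split; [|split; [|split; [|split]]]]]].
- split; first by move=> [i f]; apply/leE.
  split=> [[i f] [i1 g] [i2 h] l1 l2|[i f] [i1 g] l1 l2].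
    have /= e := dunion_le_tag l1; case: i1 / e g l1 l2 => g l1 l2.
    have /= e := dunion_le_tag l2; case: i2 / e h l2 => h /leE l2.
    by move/leE: l1 => l1; apply/leE => j; apply: trans (l1 j) (l2 j).
  have /= e := dunion_le_tag l1; case: i1 / e g l1 l2 => g /leE l1 /leE l2.
  by congr existT; apply: functional_extensionality_dep => j; apply: anti.
- by move=> [i f]; exists i; apply/leE => j; apply: root.
- by move=> i i' z /dunion_le_tag /= -> /dunion_le_tag /= ->.
- move=> i j z /splitZ[f ->]; exists (emb (f j)); split=> //; split; last exact: great.
  exact/emb_le.
- move=> i z w /splitZ[f ->] /splitZ[g ->] h; apply/leE => j.
  by apply/emb_le; apply: (h j) => //; apply/emb_le.
- move=> i a ha; have h j := (coord_standard j (a j)).1 (ha j).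
  pose f j := sval (cid (h j)).
  have fE j : a j = emb (f j) by exact: svalP (cid (h j)).
  exists (existT (fun i => product (@S i)) i f); split.
    by apply/leE => j; apply: root.
  by move=> j; rewrite fE; split=> [|b]; [apply/emb_le|apply: great].
- move=> i z /splitZ[f ->] ch.
  have [[j fj]|nj] := pselect (exists j, f j <> r j).
    by right; exists j; apply/coord_standard; exists (f j); apply: chain_emb.
  left; congr existT; apply: functional_extensionality_dep => j.
  by apply: contrapT => fj; apply: nj; exists j.
- by move=> i j t; apply: embC.
Qed.

End Standard.

(** * Transfer of the decomposition to elementarily equivalent structures *)

(** Pigeonhole: if every [f] failed at some rank, all would fail at one common rank. *)
Lemma eventually_constant (F : finType) (P : F -> nat -> Prop) :
  (forall f m k, (m <= k)%N -> P f k -> P f m) ->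
  (forall k, exists f, P f k) -> exists f, forall k, P f k.
Proof.
move=> mono h; apply: contrapT => nf.
have [|f|k hk] := @uniform_rank F (fun f k => ~ P f k).
- by move=> f m k mk nP /(mono _ _ _ mk).
- by apply: contrapT => nk; apply: nf; exists f => k; apply: contrapT => nP; apply: nk; exists k.
by have [f] := h k; apply: hk.
Qed.

(** Each rank [k] gives a frame of [Z] whose axes are [k]-equivalent to the factors, but the frame
    varies with [k]. All these frames have the axes of a renaming [t0 \o f] of one fixed frame, and
    some single [f] works for every [k]. *)
Lemma decompose (I : finType) (J : I -> finType) (n : forall i, J i -> nat)
    (S : forall i, J i -> structure)
    (r : forall i (j : J i), S i j) (c : forall i (j : J i), 'I_(n i j) -> S i j) Z :
  (forall i (j : J i), finite_tree (r i j) (c i j)) ->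
  EFequiv (dunion (fun i => product (S i))) Z ->
  exists S' : forall i, J i -> structure,
    isomorphic Z (dunion (fun i => product (S' i))) /\
    forall i j, EFequiv (S i j) (S' i j) /\
                (countable [set: Z] -> countable [set: S' i j]).
Proof.
move=> ST h.
have [q0 hq0] := fo_frame n.
pose Q (p : {i : I & J i}) q := forall k X Y (v : label n -> X) (w : label n -> Y),
  eqv (k + q) v w -> eqv k (@no_vars (sub (coord v (tagged p))))
                           (@no_vars (sub (coord w (tagged p)))).
have [||q hq] := @uniform_rank _ Q.
- move=> p m1 m2 m12 H k X Y v w e; apply: H.
  by apply: eqv_le e; rewrite leq_add2l.
- by move=> p; apply: (eqv_sub (D := fun X v => coord v (tagged p))); apply: fo_coord.
pose tX := standard r c.
have FX : frame tX by exact: standard_frame.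
have play k : exists t : label n -> Z, frame t /\ forall i j,
    eqv k (@no_vars (S i j)) (@no_vars (sub (coord t j))).
  (* The first rounds copy the standard frame to [Z]; the remaining ones suffice to recognize a
     frame and to play [k] rounds inside each axis. *)
  have := h (#|label n| + (maxn q0 (k + q))).
  move=> /eqv_play /(_ tX) [t /(eqv_reindex inr) e]; exists t; split.
    exact: hq0 (eqv_le (leq_maxl _ _) e) FX.
  move=> i j; apply: eqv_trans (iso_EF (coord_iso ST j) k) _.
  exact: (hq (existT _ i j) k _ _ _ _ (eqv_le (leq_maxr _ _) e)).
have [t0 [F0 _]] := play 0.
(* The isomorphism is recorded directly, since [frame_align] gives equality of axes and not that
   [t0 \o f] is a frame. *)
have [||f hf] := @eventually_constant {ffun label n -> label n} (fun f k =>
  isomorphic Z (dunion (fun i => product (fun j => sub (coord (t0 \o f) (j : J i))))) /\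
  forall i j, eqv k (@no_vars (S i j)) (@no_vars (sub (coord (t0 \o f) j)))).
- by move=> f m k mk [H1 H2]; split=> // i j; apply: eqv_le mk (H2 i j).
- move=> k; have [t [Ft ht]] := play k; have [f hf] := frame_align F0 Ft.
  exists f; split=> [|i j]; last by rewrite hf.
  have [g gh] := frame_iso Ft.
  have -> : (fun i => product (fun j : J i => sub (coord (t0 \o f) j))) =
            (fun i => product (fun j : J i => sub (coord t j))).
    apply: funext => i; congr product; apply: funext => j; by rewrite hf.
  by exists g.
exists (fun i j => sub (coord (t0 \o f) j)); split; first by case: (hf 0).
move=> i j; split=> [k|]; first by case: (hf k) => _; apply.
move=> /countable_injP[g gI]; apply/countable_injP; exists (fun x => g (sval x)).
by move=> x y _ _ /gI E; apply: sval_inj; apply: E; rewrite inE.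
Qed.

(** Once the root and the generators are named, being such a tree is first-order, so the names only
    have to be copied to [Y]. *)
Lemma decompose_finite_tree n X (r : X) (c : 'I_n -> X) Y :
  finite_tree r c -> EFequiv X Y ->
  exists (r' : Y) (c' : 'I_n -> Y), finite_tree r' c'.
Proof.
move=> T h; have [q hq] := fo_finite_tree n.
have := h (#|{: option 'I_n}| + q).
move=> /eqv_play /(_ (ext c r)) [t /(eqv_reindex inr) e].
exists (t None), (fun u => t (Some u)); exact: hq e T.
Qed.

Lemma finite_tree_exists X : initially_finite_tree X ->
  exists n (r : X) (c : 'I_n -> X), finite_tree r c.
Proof.
case=> -[[refl trans anti] tree] [r [root]].
move=> /(finite_seqP (T := {classic set (remove r)}))[s hs].
(* Linearity of down-sets keeps a common lower bound along a connecting path: of the two bounds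
   below the middle point the smaller one survives. *)
have low (x y : remove r) : Relation_Operators.clos_refl_sym_trans _ (@le _) x y ->
    near r (sval x) (sval y).
  elim=> {x y} [x y l|x|x y _ [u [ur [h1 h2]]]|].
  - by exists (sval x); split; [exact: svalP x|split=> //; apply: refl].
  - by exists (sval x); split; [exact: svalP x|split; apply: refl].
  - by exists u.
  - move=> x y z _ [u [ur [h1 h2]]] _ [w [wr [h3 h4]]].
    have [l|l] := tree _ _ _ h2 h3; [exists u|exists w]; split=> //; split=> //.
      exact: trans l h4.
    exact: trans l h1.
pose cls (x : remove r) : {classic set (remove r)} :=
  [set y | Relation_Operators.clos_refl_sym_trans _ (@le _) x y].
(* One point is chosen in each listed component; the default [r] only makes [c] total. *)
pose c (t : 'I_(size s)) : X :=
  if pselect (exists x, cls x = tnth (in_tuple s) t) is left h then sval (sval (cid h)) else r.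
exists (size s), r, c; split; [|split; [|split]] => //.
move=> z; have [->|zr] := pselect (z = r); [by left|right].
pose z' : remove r := exist _ z zr.
have : cls z' \in s.
  by have : [set` s] (cls z') by rewrite -hs; exists z'.
move=> /(tnthP (in_tuple s))[t ht]; exists t; rewrite /c; case: pselect => [h|[]]; last by exists z'.
case: cid => x /=; rewrite -ht => E.
have : cls x z' by rewrite E; apply: Relation_Operators.rst_refl.
by move/low => [u [ur [h1 h2]]]; exists u.
Qed.

(** * Normal form of the generated class *)

Lemma iso_product (J : Type) (S S' : J -> structure) :
  (forall j, isomorphic (S j) (S' j)) -> isomorphic (product S) (product S').
Proof.
move=> h; pose f j := sval (cid (h j)); have fP j := svalP (cid (h j)).
exists (fun a j => f j (a j)); split; last first.
  move=> x y; split=> l j; have [_ e] := fP j.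
    exact: (e _ _).1 (l j).
  exact: (e _ _).2 (l j).
apply: iso_bij => [a b E|y].
  apply: functional_extensionality_dep => j; have [/bij_inj e _] := fP j.
  by apply: e; move: (congr1 (fun u => u j) E).
have g j : exists x, f j x = y j by have [[g _ gK] _] := fP j; exists (g (y j)); apply: gK.
exists (fun j => sval (cid (g j))); apply: functional_extensionality_dep => j.
exact: svalP (cid (g j)).
Qed.

Lemma iso_dunion (J : eqType) (S S' : J -> structure) :
  (forall j, isomorphic (S j) (S' j)) -> isomorphic (dunion S) (dunion S').
Proof.
move=> h; pose f j := sval (cid (h j)); have fP j := svalP (cid (h j)).
exists (fun p => existT (fun j => S' j) (projT1 p) (f (projT1 p) (projT2 p))); split.
  apply: iso_bij => [[i a] [j b] /= E|[j y]].
    have /= e := congr1 (@projT1 _ _) E; case: j / e b E => b /(@existT_inj2 _ S') E.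
    by congr existT; have [/bij_inj e _] := fP i; apply: e.
  by have [[g _ gK] _] := fP j; exists (existT _ j (g y)); congr existT; apply: gK.
move=> [i a] [j b]; split=> l; have /= e := dunion_le_tag l;
  case: j / e b l => b /dunion_leE l; apply/dunion_leE; have [_ e] := fP i.
  exact: (e _ _).1 l.
exact: (e _ _).2 l.
Qed.

Lemma iso_product2 X X' Y Y' :
  isomorphic X X' -> isomorphic Y Y' -> isomorphic (product2 X Y) (product2 X' Y').
Proof.
move=> [f [[f' fK f'K] fh]] [g [[g' gK g'K] gh]].
exists (fun p => (f p.1, g p.2)); split.
  by exists (fun p => (f' p.1, g' p.2)) => -[x y] /=; rewrite ?fK ?gK ?f'K ?g'K.
by move=> [x y] [x' y'] /=; rewrite -fh -gh.
Qed.

Lemma iso_dunion2 X X' Y Y' :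
  isomorphic X X' -> isomorphic Y Y' -> isomorphic (dunion2 X Y) (dunion2 X' Y').
Proof.
move=> [f [[f' fK f'K] fh]] [g [[g' gK g'K] gh]].
exists (fun p => match p with inl x => inl (f x) | inr y => inr (g y) end); split.
  exists (fun p => match p with inl x => inl (f' x) | inr y => inr (g' y) end);
    by case=> x; rewrite ?fK ?gK ?f'K ?g'K.
by move=> [x|y] [x'|y'] /=.
Qed.

(** Products distribute over disjoint unions: summands are indexed by pairs, and the two lists of
    factors are concatenated. Arbitrary finite index types avoid renumbering. *)
Lemma generated_normal K X : generated K X ->
  exists (I : finType) (J : I -> finType) (S : forall i, J i -> structure),
    (forall i j, K (S i j)) /\ isomorphic X (dunion (fun i => product (S i))).
Proof.
elim=> {X} [X KX|X Y _ [I [J [S [KS XS]]]] _ [I' [J' [S' [KS' YS']]]]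
           |X Y _ [I [J [S [KS XS]]]] _ [I' [J' [S' [KS' YS']]]]
           |X Y XY _ [I [J [S [KS XS]]]]].
- exists unit, (fun _ => unit), (fun _ _ => X); split=> //.
  exists (fun x => existT (fun i => product (fun _ : unit => X)) tt (fun _ => x)); split.
    apply: iso_bij => [x y /(@existT_inj2 _ (fun i => product (fun _ : unit => X)))|[[] g]].
      by move/(congr1 (fun u => u tt)).
    by exists (g tt); congr existT; apply: functional_extensionality_dep => -[].
  move=> x y; rewrite (dunion_leE (S := fun i : unit => product (fun _ : unit => X))).
  by split=> [l []|/(_ tt)].
- pose T (p : I * I') (u : J p.1 + J' p.2) : structure :=
    match u with inl j => S p.1 j | inr l => S' p.2 l end.
  exists (I * I')%type, (fun p => (J p.1 + J' p.2)%type), T; split=> [p [j|l]|]; rewrite /= ?KS ?KS' //.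
  apply: iso_trans (iso_product2 XS YS') _.
  pose F (z : product2 (dunion (fun i => product (S i))) (dunion (fun i => product (S' i)))) :
      dunion (fun p => product (@T p)) :=
    existT (fun p => product (@T p)) (projT1 z.1, projT1 z.2)
      (fun u => match u return T (projT1 z.1, projT1 z.2) u with
                | inl j => projT2 z.1 j | inr l => projT2 z.2 l end).
  have FE x y : le x y <-> le (F x) (F y).
    case: x y => [[i a] [k b]] [[i' a'] [k' b']]; split.
      case=> /= l1 l2; have /= e1 := dunion_le_tag l1; have /= e2 := dunion_le_tag l2.
      case: i' / e1 a' l1 => a' /(dunion_leE (S := fun i => product (S i))) l1.
      case: k' / e2 b' l2 => b' /(dunion_leE (S := fun i => product (S' i))) l2.
      apply/(dunion_leE (S := fun p => product (@T p))) => -[j|l]; [exact: l1|exact: l2].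
    move=> l; have /= [e1 e2] := dunion_le_tag l.
    case: i' / e1 a' l => a'; case: k' / e2 b' => b'.
    move=> /(dunion_leE (S := fun p => product (@T p))) l; split.
      by apply/(dunion_leE (S := fun i => product (S i))) => j; apply: (l (inl j)).
    by apply/(dunion_leE (S := fun i => product (S' i))) => j; apply: (l (inr j)).
  exists F; split=> //; apply: iso_bij => [[[i a] [k b]] [[i' a'] [k' b']]|[[i k] g]].
    rewrite /F /= => E; have /= [e1 e2] := congr1 (@projT1 _ _) E.
    case: i' / e1 a' E => a'; case: k' / e2 b' => b'.
    move=> /(@existT_inj2 _ (fun p => product (@T p))) E.
    have -> : a = a'.
      apply: functional_extensionality_dep => j; exact: (congr1 (fun u => u (inl j)) E).
    have -> // : b = b'.
    apply: functional_extensionality_dep => j; exact: (congr1 (fun u => u (inr j)) E).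
  exists (existT (fun i => product (S i)) i (fun j => g (inl j)),
          existT (fun i => product (S' i)) k (fun l => g (inr l))).
  by rewrite /F /=; congr existT; apply: functional_extensionality_dep => -[].
- pose JJ (s : I + I') : finType := match s with inl i => J i | inr k => J' k end.
  pose T (s : I + I') : JJ s -> structure := match s with inl i => S i | inr k => S' k end.
  exists (I + I')%type, JJ, T; split=> [[i|k] j|]; rewrite /= ?KS ?KS' //.
  apply: iso_trans (iso_dunion2 XS YS') _.
  pose F (z : dunion2 (dunion (fun i => product (S i))) (dunion (fun i => product (S' i)))) :
      dunion (fun p => product (@T p)) :=
    match z with
    | inl (existT i a) => existT (fun p => product (@T p)) (inl i) a
    | inr (existT k b) => existT (fun p => product (@T p)) (inr k) b
    end.
  exists F; split; last first.
    move=> [[i a]|[i a]] [[i' a']|[i' a']]; split=> l //.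
    + have /= e := dunion_le_tag l; case: i' / e a' l => a' l.
      apply/(dunion_leE (S := fun p => product (@T p))).
      exact/(dunion_leE (S := fun i => product (S i))).
    + have /= [e] := dunion_le_tag l; case: i' / e a' l => a' l.
      apply/(dunion_leE (S := fun i => product (S i))).
      exact/(dunion_leE (S := fun p => product (@T p)) (j := inl i)).
    + by have := dunion_le_tag l.
    + by have := dunion_le_tag l.
    + have /= e := dunion_le_tag l; case: i' / e a' l => a' l.
      apply/(dunion_leE (S := fun p => product (@T p))).
      exact/(dunion_leE (S := fun i => product (S' i))).
    + have /= [e] := dunion_le_tag l; case: i' / e a' l => a' l.
      apply/(dunion_leE (S := fun i => product (S' i))).
      exact/(dunion_leE (S := fun p => product (@T p)) (j := inr i)).
  apply: iso_bij => [[[i a]|[i a]] [[i' a']|[i' a']] E|[[i|k] g]].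
  + have /= [e] := congr1 (@projT1 _ _) E; case: i' / e a' E => a'.
    by move=> /(@existT_inj2 _ (fun p => product (@T p)) (inl i)) ->.
  + by have := congr1 (@projT1 _ _) E.
  + by have := congr1 (@projT1 _ _) E.
  + have /= [e] := congr1 (@projT1 _ _) E; case: i' / e a' E => a'.
    by move=> /(@existT_inj2 _ (fun p => product (@T p)) (inr i)) ->.
  + by exists (inl (existT _ i g)).
  + by exists (inr (existT _ k g)).
- exists I, J, S; split=> //; exact: iso_trans (iso_sym XY) XS.
Qed.

(** * Counting models *)

Lemma card_le_inj (T U : Type) (A : set T) (B : set U) (f : T -> U) :
  (forall x, A x -> B (f x)) -> (forall x y, A x -> A y -> f x = f y -> x = y) ->
  A #<= B.
Proof.
move=> fB fI; apply: (@card_le_trans _ _ _ (f @` A)); last first.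
  by apply: subset_card_le => _ [x Ax <-]; apply: fB.
have /card_eqPle[_ //] : f @` A #= A.
by apply: inj_card_eq => x y; rewrite !inE; apply: fI.
Qed.

Lemma card_leE (T : Type) (U : pointedType) (A : set T) (B : set U) : A #<= B ->
  exists f : T -> U, (forall x, A x -> B (f x)) /\
    (forall x y, A x -> A y -> f x = f y -> x = y).
Proof.
move=> /pcard_leP/injfunPex[f fB fI]; exists f; split=> // x y Ax Ay.
by apply: fI; rewrite inE.
Qed.

Lemma infinite_inj (T U : Type) (f : T -> U) :
  injective f -> infinite_set [set: T] -> infinite_set [set: U].
Proof.
move=> fI infT; apply: contra_not infT; apply: card_le_finite.
by apply: (card_le_inj (f := f)) => // x y _ _ /fI.
Qed.

(** All points of [X] are played first; one further round shows that their images exhaust [Z]. *)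
Lemma finite_iso X Z : finite_set [set: X] -> EFequiv X Z -> isomorphic X Z.
Proof.
move=> /(finite_seqP (T := {classic X}))[s hs] h.
pose e (t : 'I_(size s)) : X := tnth (in_tuple s) t.
have /choice[ix ixP] x : exists t, e t = x.
  have : (x : {classic X}) \in s.
    by have : [set` s] (x : {classic X}) by rewrite -hs.
  by move=> /(tnthP (in_tuple s))[t ->]; exists t.
have := h (#|'I_(size s)| + 1).
move=> /eqv_play /(_ e)[b /(eqv_reindex inr) hb].
have h0 : eqv 0 e b by exact: eqv_le hb.
exists (fun x => b (ix x)); split; last first.
  by move=> x y; have [] := h0 (ix x) (ix y); rewrite !ixP.
apply: iso_bij => [x y E|z].
  by rewrite -[x]ixP -[y]ixP; apply/(h0 _ _).2.
case: hb => _ /(_ z)[x hx]; exists x.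
have [_ E] := hx None (Some (ix x)); have {}E := E.1 (esym (ixP x)).
exact: esym E.
Qed.

Lemma iso_type_iso X Y : isomorphic X Y -> iso_type X = iso_type Y.
Proof.
move=> XY; apply: funext => R; apply: propext; split=> h.
  exact: iso_trans (iso_sym XY) h.
exact: iso_trans XY h.
Qed.

Lemma iso_type_ex X : countable [set: X] -> infinite_set [set: X] ->
  exists R, iso_type X R.
Proof.
move=> cX iX; have /card_set_bijP[f [_ fI fS]] := eq_card_nat cX iX.
have fb : bijective f.
  apply: iso_bij => [x y|m]; first by apply: fI; rewrite inE.
  by have [x _ <-] := fS m I; exists x.
have [g fK gK] := fb.
exists (fun a b => le (g a) (g b)), f; split=> // x y /=.
by rewrite !fK.
Qed.

Definition representative (C : set (nat -> nat -> Prop)) : nat -> nat -> Prop :=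
  if pselect (exists R, C R) is left h then sval (cid h) else fun _ _ => True.

Lemma representativeP X : countable [set: X] -> infinite_set [set: X] ->
  isomorphic X (Structure (representative (iso_type X))).
Proof.
move=> cX iX; rewrite /representative; case: pselect => [h|[]].
  exact: svalP (cid h).
exact: iso_type_ex.
Qed.

Lemma infinite_EF X Y : infinite_set [set: X] -> EFequiv X Y -> infinite_set [set: Y].
Proof.
move=> iX h fY; have [f [fb _]] := finite_iso fY (EF_sym h).
by case: fb => g fK gK; apply: infinite_inj (can_inj gK) iX fY.
Qed.

(** This turns the bound into a statement about games. It also covers finite [X], where there are no
    types to count and [finite_iso] provides the isomorphism. *)
Lemma I_types_le1P X : I_types X #<= `I_1 <->
  forall Y Z, countable [set: Y] -> countable [set: Z] ->
    EFequiv X Y -> EFequiv X Z -> isomorphic Y Z.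
Proof.
split=> [h Y Z cY cZ XY XZ|h].
  have [fX|iX] := pselect (finite_set [set: X]).
    exact: iso_trans (iso_sym (finite_iso fX XY)) (finite_iso fX XZ).
  have iY := infinite_EF iX XY.
  have [R YR] := iso_type_ex cY iY.
  suff E : iso_type Y = iso_type Z.
    by have := YR; rewrite E => ZR; apply: iso_trans YR (iso_sym ZR).
  have tY : I_types X (iso_type Y) by split=> //; exists Y; split=> //; apply: EF_model.
  have tZ : I_types X (iso_type Z) by split=> //; exists Z; split=> //; apply: EF_model.
  have [f [f0 fI]] := card_leE h; apply: fI => //.
  by have := f0 _ tY; have := f0 _ tZ; rewrite /= !ltnS !leqn0 => /eqP -> /eqP ->.
have [[C IC]|nI] := pselect (exists C, I_types X C); last first.
  have -> : I_types X = set0 by apply/seteqP; split=> // C IC; apply: nI; exists C.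
  exact: card_ge0.
apply: (@card_le_trans _ _ _ [set C]); last first.
  by have /card_eqPle[] := @card_set1 _ C.
apply: subset_card_le => C' [_ [Y [cY mY ->]]] /=.
have [_ [Z [cZ mZ ->]]] := IC.
by apply: iso_type_iso; apply: h => //; apply: sat_EF.
Qed.

(** An isomorphism type is determined by one relation on the natural numbers, coded as a set of
    numbers by a pairing. *)
Lemma I_types_le_continuum X : I_types X #<= [set: set nat].
Proof.
apply/pcard_injP; exists (fun C => [set m | exists a b : nat, m = pickle (a, b) /\ representative C a b]).
move=> C D; rewrite !inE => -[iX [Y [cY mY EC]]] [_ [Z [cZ mZ ED]]] E.
have repP (W : structure) : countable [set: W] -> is_model (Th X) W ->
    iso_type W (representative (iso_type W)).
  by move=> cW mW; apply: representativeP => //; apply: infinite_EF iX (sat_EF mW).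
have Ep : representative C = representative D.
  apply: funext => a; apply: funext => b; apply: propext.
  have {}E : (exists a' b' : nat, pickle (a, b) = pickle (a', b') /\ representative C a' b') <->
    (exists a' b' : nat, pickle (a, b) = pickle (a', b') /\ representative D a' b').
    by move: (congr1 (fun A : set nat => A (pickle (a, b))) E) => /= ->.
  by split=> h; [case: E.1|case: E.2]; (try by exists a, b); move=> a' [b' [/(pcan_inj pickleK)[-> ->]]].
rewrite EC ED; apply: iso_type_iso.
have hY : iso_type Y (representative D) by have := repP Y cY mY; rewrite -EC Ep EC.
have hZ : iso_type Z (representative D) by have := repP Z cZ mZ; rewrite -ED.
exact: iso_trans hY (iso_sym hZ).
Qed.

(* König's argument: if the continuum is covered by countably many sets, then one
   of them projects onto a factor of [(set nat)^nat], which is again the continuum. *)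
Lemma continuum_fibres (T U : pointedType) (A : set T) (B : set U)
    (F : T -> U) (k : T -> nat) :
  [set: set nat] #<= A -> (forall x, A x -> B (F x)) ->
  (forall x y, A x -> A y -> F x = F y -> k x = k y -> x = y) ->
  [set: set nat] #<= B.
Proof.
move=> /card_leE[h [hA hI]] FB FI.
pose dec (s : set nat) (m : nat) : set nat := [set i | s (pickle (m, i))].
(* Read a set of numbers as a sequence of rows. On some fibre of [k] the row of that index takes all
   values; otherwise the set whose row [m] is a value missed on fibre [m] contradicts its own
   fibre. *)
have [m /choice[g hg]] : exists m, forall y, exists s, k (h s) = m /\ dec s m = y.
  apply: contrapT => nm.
  have /choice[y hy] : forall m, exists y, forall s, k (h s) = m -> dec s m <> y.
    move=> m; apply: contrapT => ny; apply: nm; exists m => y; apply: contrapT => ns.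
    by apply: ny; exists y => s ks ds; apply: ns; exists s.
  pose s : set nat := [set n | exists m i, n = pickle (m, i) /\ y m i].
  apply: (hy (k (h s)) s erefl); apply: funext => i; apply: propext.
  split=> [[m [i' [/(pcan_inj pickleK)[-> ->]]]] //|yi].
  by exists (k (h s)), i.
apply: (card_le_inj (f := fun y => F (h (g y)))) => [y _|y z _ _ E].
  by apply: FB; apply: hA.
have [ky <-] := hg y; have [kz <-] := hg z; congr dec; apply: hI => //.
by apply: FI => //; [apply: hA|apply: hA|rewrite ky kz].
Qed.

(** Axes are first-order definable from [r] and [c], so isomorphisms respect them. *)
Lemma iso_axis X Y (f : X -> Y) n (r : X) (c : 'I_n -> X) :
  bijective f -> (forall x y, le x y <-> le (f x) (f y)) ->
  isomorphic (sub (axis r c)) (sub (axis (f r) (f \o c))).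
Proof.
move=> fb fh.
have [q hq] : fo (fun Z (v : option (option 'I_n) -> Z) =>
    axis (v (Some None)) (fun t => v (Some (Some t))) (v None)).
  by rewrite /axis /chain /near; fo_auto.
have axisE z : axis r c z <-> axis (f r) (f \o c) (f z).
  have e := iso_eqv fb fh q (ext (ext c r) z).
  by split; [apply: hq e|apply: (hq _ _ _ _ (eqv_sym e))].
exists (fun x => exist _ (f (sval x)) ((axisE _).1 (svalP x))); split; last first.
  by move=> x y; apply: fh.
apply: iso_bij => [x y /(congr1 sval) /= /(bij_inj fb) /sval_inj //|[y hy]].
case: fb => g fK gK; have hx : axis r c (g y) by apply/axisE; rewrite gK.
by exists (exist _ (g y) hx); apply: sval_inj; apply: gK.
Qed.

Lemma countable_product (J : finType) (S : J -> structure) :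
  (forall j, countable [set: S j]) -> countable [set: product S].
Proof.
move=> h; have g j : exists f : S j -> nat, injective f.
  by have /countable_injP[f fI] := h j; exists f => x y; apply: fI; rewrite inE.
apply/countable_injP.
exists (fun a => pickle [ffun j => sval (cid (g j)) (a j)]) => a b _ _.
move=> /(pcan_inj pickleK)/ffunP E; apply: functional_extensionality_dep => j.
by apply: (svalP (cid (g j))); have := E j; rewrite !ffunE.
Qed.

Lemma countable_dunion (J : finType) (S : J -> structure) :
  (forall j, countable [set: S j]) -> countable [set: dunion S].
Proof.
move=> h; have g j : exists f : S j -> nat, injective f.
  by have /countable_injP[f fI] := h j; exists f => x y; apply: fI; rewrite inE.
apply/countable_injP.
exists (fun p => pickle (projT1 p, sval (cid (g (projT1 p))) (projT2 p))) => -[i a] [j b] _ _.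
move=> /(pcan_inj pickleK) /= E; have [e _] := E; case: j / e b E => b [E].
by congr existT; apply: (svalP (cid (g i))).
Qed.

Unset Implicit Arguments.

(** * Model counts of disjoint unions of products *)

Section Sums.
Variables (I : finType) (J : I -> finType) (S : forall i, J i -> structure).
Hypothesis ST : forall i j, initially_finite_tree (S i j).
Variable X : structure.
Hypothesis XS : isomorphic X (dunion (fun i => product (S i))).

Let tree i j := cid (finite_tree_exists (ST i j)).
Let n i j := sval (tree i j).
Let tree' i j := cid (svalP (tree i j)).
Let r i j : S i j := sval (tree' i j).
Let tree'' i j := cid (svalP (tree' i j)).
Let c i j : 'I_(n i j) -> S i j := sval (tree'' i j).

Lemma summands_finite_tree i j : finite_tree (r i j) (c i j).
Proof. exact: svalP (tree'' i j). Qed.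

(** Two countable models decompose over the same index sets into countable models of the theories of
    the factors, and these are isomorphic factor by factor. *)
Lemma I_types_le1_sums :
  (forall i j, I_types (S i j) #<= `I_1) -> I_types X #<= `I_1.
Proof.
move=> h; apply/I_types_le1P => Y Z cY cZ XY XZ.
have [S1 [Y1 h1]] := decompose summands_finite_tree (EF_trans (EF_sym (iso_EF XS)) XY).
have [S2 [Z2 h2]] := decompose summands_finite_tree (EF_trans (EF_sym (iso_EF XS)) XZ).
apply: iso_trans Y1 (iso_trans _ (iso_sym Z2)).
apply: iso_dunion => i; apply: iso_product => j.
have [e1 /(_ cY) c1] := h1 i j; have [e2 /(_ cZ) c2] := h2 i j.
by have /I_types_le1P := h i j; apply.
Qed.

(** The type of [W] is sent to the type of the sum with [W] at place [j0] of summand [i0]. This type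
    and one number locating the bottom and the generators determine [W], so [continuum_fibres]
    applies. *)
Lemma I_eq_continuum_sums i0 j0 : I_eq_continuum (S i0 j0) -> I_eq_continuum X.
Proof.
move=> hc; apply/card_eqPle; split; first exact: I_types_le_continuum.
have /card_eqPle[_ ge] := hc.
have infS : infinite_set [set: S i0 j0].
  have [f [fA _]] := card_leE ge; by case: (fA set0 Logic.I).
have infX : infinite_set [set: X].
  apply: infinite_EF _ (iso_EF (iso_sym XS)); apply: infinite_inj infS.
  exact: (emb_inj (r := r) (j := j0)).
(* The other factors may be uncountable; countable models of their theories fill these places. *)
pose LS i j := cid (countable_EF (r i j)); pose M i j := sval (LS i j).
have hM i j : countable [set: M i j] /\ EFequiv (S i j) (M i j) := svalP (LS i j).
(* The number codes the bottom and the generators as points of the representative, whose axis is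
   then a copy of [W]. *)
pose rebuild (p : set (nat -> nat -> Prop) * nat) : structure :=
  let: (r, c) := odflt (0, [ffun=> 0]) (unpickle p.2 : option (nat * {ffun 'I_(n i0 j0) -> nat})) in
  sub (@axis (Structure (representative p.1)) _ r c).
have /choice[G hG] : forall C, exists p, I_types (S i0 j0) C ->
    I_types X p.1 /\ exists W, C = iso_type W /\ isomorphic W (rebuild p).
  move=> C; have [AC|nAC] := pselect (I_types (S i0 j0) C); last by exists (set0, 0).
  have [_ [W [cW mW EC]]] := AC.
  (* Whole pairs are compared because [j] and [j0] live in different types. *)
  pose fam i j := if existT J i j == existT J i0 j0 then W else M i j.
  have famEF i j : EFequiv (S i j) (fam i j).
    rewrite /fam; case: eqP => [E|_]; last by case: (hM i j).
    have /= e := congr1 (@projT1 _ _) E; subst i.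
    by rewrite (existT_inj2 E); apply: sat_EF.
  have famC i j : countable [set: fam i j].
    by rewrite /fam; case: eqP => // _; case: (hM i j).
  have famW : fam i0 j0 = W by rewrite /fam eqxx.
  have T i j := cid (decompose_finite_tree (summands_finite_tree i j) (famEF i j)).
  pose r' i j := sval (T i j).
  have T' i j := cid (svalP (T i j)).
  pose c' i j := sval (T' i j).
  have T'' i j : finite_tree (r' i j) (c' i j) := svalP (T' i j).
  pose Y := dunion (fun i => product (fam i)).
  have cY : countable [set: Y].
    by apply: countable_dunion => i; apply: countable_product => j.
  have XY : EFequiv X Y.
    apply: EF_trans (iso_EF XS) _.
    apply: (EF_dunion (fun i => r i : product (S i)) (fun i => r' i : product (fam i))) => i.
    exact: EF_product.
  have IY : I_types X (iso_type Y).
    by split=> //; exists Y; split=> //; apply: EF_model.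
  have [f [fb fh]] : isomorphic Y (Structure (representative (iso_type Y))).
    by apply: representativeP => //; apply: infinite_EF infX XY.
  pose t := standard r' c'.
  exists (iso_type Y, pickle (f (bottom t i0), [ffun s => f (gen t (j := j0) s)])) => _.
  split=> //; exists W; split=> //.
  rewrite /rebuild /= pickleK /= -[W]famW.
  apply: iso_trans (coord_iso T'' j0) _.
  have := iso_axis (bottom t i0) (gen t (j := j0)) fb fh.
  by congr (isomorphic _ (sub (axis _ _))); apply: funext => s; rewrite /= ffunE.
apply: (continuum_fibres (F := fun C => (G C).1) (k := fun C => (G C).2) ge).
  by move=> C /hG[].
move=> C D /hG[_ [W [-> Wi]]] /hG[_ [W' [-> Wi']]] E1 E2; apply: iso_type_iso.
apply: iso_trans Wi (iso_sym _).
by rewrite [G (iso_type W)]surjective_pairing E1 E2 -surjective_pairing.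
Qed.

(** If no factor has continuum many countable models, each has at most one, and the sum has at most
    one. *)
Lemma VCsharp_sums : (forall i j, VCsharp (S i j)) -> VCsharp X.
Proof.
move=> h; have [[i [j hc]]|nc] := pselect (exists i j, I_eq_continuum (S i j)).
  by apply: Or33; apply: I_eq_continuum_sums hc.
have le1 : I_types X #<= `I_1.
  apply: I_types_le1_sums => i j; case: (h i j) => [h0|h1|hc].
  - have /card_eqPle[h' _] := h0; apply: card_le_trans h' _; by rewrite card_le_II.
  - by have /card_eqPle[] := h1.
  - by case: nc; exists i, j.
have /finite_set_leP/finite_setP[m hm] : exists m, I_types X #<= `I_m by exists 1%N.
have : `I_m #<= `I_1 by move: le1; rewrite (card_le_eql hm).
rewrite card_le_II; case: m hm => [|[|//]] hm _; [exact: Or31|exact: Or32].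
Qed.

End Sums.

Theorem theorem4p8 :
  (forall X : structure, generated classK X -> VCsharp X) /\
  (forall (n : nat) (m : 'I_n -> nat)
      (S : forall i : 'I_n, 'I_(m i) -> structure) (X : structure),
    (0 < n)%N -> (forall i, (0 < m i)%N) ->
    (forall i j, classK (S i j)) ->
    isomorphic X (dunion (fun i => product (S i))) ->
    ((forall i j, I_types (S i j) #<= `I_1) -> I_types X #<= `I_1) /\
    ((exists i j, I_eq_continuum (S i j)) -> I_eq_continuum X)).
Proof.
split=> [X /generated_normal[I [J [S [KS XS]]]]|n m S X _ _ KS XS].
  by apply: (VCsharp_sums _ _ S _ _ XS) => i j; case: (KS i j).
have ST i j : initially_finite_tree (S i j) by case: (KS i j).
split=> [|[i [j]]]; first exact: (I_types_le1_sums _ (fun i => 'I_(m i)) S ST X XS).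
exact: (I_eq_continuum_sums _ (fun i => 'I_(m i)) S ST X XS).
Qed.
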